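(* Let $\mathcal{G}$ be a magmoidal category, let $\mathcal{H}$ be a semigroupal category with associativity constraint $\psi$ (for instance a monoidal category), and let $F:\mathcal{G}\to\mathcal{H}$ be a quasi-monoidal functor with structure isomorphisms $F_{X,Y}$. Then the full subcategory $\mathcal{N}_l(F)$ is closed under the tensor product in $\mathcal{N}_l(\mathcal{G})$, and $F$ lifts to a semigroupal functor $\overline F:\mathcal{N}_l(F)\to\mathcal{H}$, $\overline F(A,a)=F(A)$, with structure isomorphisms $F_{A,B}:F(A\otimes B)\to F(A)\otimes F(B)$.
   Context: A magmoidal category is a category $\mathcal{G}$ with a functor $\otimes:\mathcal{G}\times\mathcal{G}\to\mathcal{G}$, with no associativity or unit condition. A semigroupal category is a magmoidal category with a natural associativity isomorphism $\phi_{X,Y,Z}:X\otimes(Y\otimes Z)\to(X\otimes Y)\otimes Z$ satisfying the pentagon axiom (a monoidal category without unit). A semigroupal functor $F:(\mathcal{C},\phi)\to(\mathcal{D},\psi)$ is a functor with natural isomorphisms $F_{X,Y}:F(X\otimes Y)\to F(X)\otimes F(Y)$ satisfying $\psi_{F(X),F(Y),F(Z)}\circ(F(X)\otimes F_{Y,Z})\circ F_{X,Y\otimes Z}=(F_{X,Y}\otimes F(Z))\circ F_{X\otimes Y,Z}\circ F(\phi_{X,Y,Z})$. An object's name also denotes its identity morphism. The left nucleus $\mathcal{N}_l(\mathcal{G})$ has as objects pairs $(A,a)$, with $A\in\mathcal{G}$ and $a$ a family of isomorphisms $a_{X,Y}:A\otimes(X\otimes Y)\to(A\otimes X)\otimes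 Y$ natural in $X,Y$. A morphism $(A,a)\to(B,b)$ is a morphism $f:A\to B$ of $\mathcal{G}$ such that $((f\otimes X)\otimes Y)\circ a_{X,Y}=b_{X,Y}\circ(f\otimes(X\otimes Y))$ for all $X,Y$. It is semigroupal with $(A,a)\otimes(B,b)=(A\otimes B,a|b)$, where $(a|b)_{X,Y}\circ a_{B,X\otimes Y}=(a_{B,X}\otimes Y)\circ a_{B\otimes X,Y}\circ(A\otimes b_{X,Y})$, with the tensor product of morphisms taken in $\mathcal{G}$, and with associativity constraint $\phi_{(A,a),(B,b),(C,c)}=a_{B,C}$. A quasi-monoidal functor $F:\mathcal{G}\to\mathcal{H}$ is a functor equipped with a natural collection of isomorphisms $F_{X,Y}:F(X\otimes Y)\to F(X)\otimes F(Y)$ (no coherence required). $\mathcal{N}_l(F)$ is the full subcategory of $\mathcal{N}_l(\mathcal{G})$ of pairs $(A,a)$ such that for all $X,Y\in\mathcal{G}$ $$\psi_{F(A),F(X),F(Y)}\circ(F(A)\otimes F_{X,Y})\circ F_{A,X\otimes Y}=(F_{A,X}\otimes F(Y))\circ F_{A\otimes X,Y}\circ F(a_{X,Y}).$$ *)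

(* Defs.v *)
From Stdlib Require Import ssreflect ProofIrrelevance.

Set Implicit Arguments.
Unset Strict Implicit.
Unset Printing Implicit Defensive.

Declare Scope cat_scope.
Delimit Scope cat_scope with cat.
Open Scope cat_scope.

Record category := Category {
  ob :> Type;
  hom : ob -> ob -> Type;
  idm : forall X, hom X X;
  comp : forall X Y Z, hom Y Z -> hom X Y -> hom X Z;
  comp_idl : forall X Y (f : hom X Y), comp (idm Y) f = f;
  comp_idr : forall X Y (f : hom X Y), comp f (idm X) = f;
  comp_assoc : forall W X Y Z (h : hom Y Z) (g : hom X Y) (f : hom W X),
    comp h (comp g f) = comp (comp h g) f
}.

Arguments hom {c} _ _.
Arguments idm {c} X.
Arguments comp {c X Y Z} _ _.

Notation "g ∘ f" := (comp g f) (at level 40, left associativity) : cat_scope.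

Record iso (C : category) (X Y : C) := Iso {
  iso_hom :> hom X Y;
  iso_inv : hom Y X;
  iso_invl : iso_inv ∘ iso_hom = idm X;
  iso_invr : iso_hom ∘ iso_inv = idm Y
}.

Arguments iso {C} X Y.

(* The tensor product is a functor [C × C -> C], spelled out on components. *)
Record magmoidal := Magmoidal {
  mag_cat :> category;
  tens : mag_cat -> mag_cat -> mag_cat;
  tensm : forall X X' Y Y' : mag_cat,
    hom X X' -> hom Y Y' -> hom (tens X Y) (tens X' Y');
  tensm_id : forall X Y, tensm (idm X) (idm Y) = idm (tens X Y);
  tensm_comp : forall (X X' X'' Y Y' Y'' : mag_cat)
    (f' : hom X' X'') (f : hom X X') (g' : hom Y' Y'') (g : hom Y Y'),
    tensm (f' ∘ f) (g' ∘ g) = tensm f' g' ∘ tensm f g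
}.

Arguments tens {m} _ _.
Arguments tensm {m X X' Y Y'} _ _.

Notation "X ⊗ Y" := (tens X Y) (at level 38, left associativity) : cat_scope.
Notation "f ⊗₁ g" := (tensm f g) (at level 38, left associativity) : cat_scope.

Record semigroupal := Semigroupal {
  sg_mag :> magmoidal;
  assoc : forall X Y Z : sg_mag, iso (X ⊗ (Y ⊗ Z)) ((X ⊗ Y) ⊗ Z);
  assoc_nat : forall (X X' Y Y' Z Z' : sg_mag)
    (f : hom X X') (g : hom Y Y') (h : hom Z Z'),
    ((f ⊗₁ g) ⊗₁ h) ∘ assoc X Y Z = assoc X' Y' Z' ∘ (f ⊗₁ (g ⊗₁ h));
  pentagon : forall W X Y Z : sg_mag,
    assoc (W ⊗ X) Y Z ∘ assoc W X (Y ⊗ Z)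
    = (assoc W X Y ⊗₁ idm Z) ∘ assoc W (X ⊗ Y) Z ∘ (idm W ⊗₁ assoc X Y Z)
}.

Arguments assoc {s} X Y Z.

(* The data of a quasi-monoidal functor is separated from its axioms so that
   two such functors can be compared on data by a plain equality. *)
Record qm_data (C D : magmoidal) := QmData {
  qm_ob :> C -> D;
  qm_mor : forall X Y : C, hom X Y -> hom (qm_ob X) (qm_ob Y);
  qm_str : forall X Y : C, iso (qm_ob (X ⊗ Y)) (qm_ob X ⊗ qm_ob Y)
}.

Arguments qm_mor {C D} q {X Y} _.
Arguments qm_str {C D} q X Y.

Record quasi_monoidal_functor (C D : magmoidal) := QuasiMonoidalFunctor {
  qm_dat :> qm_data C D;
  qm_id : forall X : C, qm_mor qm_dat (idm X) = idm (qm_dat X);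
  qm_comp : forall (X Y Z : C) (g : hom Y Z) (f : hom X Y),
    qm_mor qm_dat (g ∘ f) = qm_mor qm_dat g ∘ qm_mor qm_dat f;
  qm_nat : forall (X X' Y Y' : C) (f : hom X X') (g : hom Y Y'),
    (qm_mor qm_dat f ⊗₁ qm_mor qm_dat g) ∘ qm_str qm_dat X Y
    = qm_str qm_dat X' Y' ∘ qm_mor qm_dat (f ⊗₁ g)
}.

Record semigroupal_functor (C D : semigroupal) := SemigroupalFunctor {
  sf_qm :> quasi_monoidal_functor C D;
  sf_coh : forall X Y Z : C,
    assoc (sf_qm X) (sf_qm Y) (sf_qm Z)
      ∘ (idm (sf_qm X) ⊗₁ qm_str sf_qm Y Z) ∘ qm_str sf_qm X (Y ⊗ Z)
    = (qm_str sf_qm X Y ⊗₁ idm (sf_qm Z))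
      ∘ qm_str sf_qm (X ⊗ Y) Z ∘ qm_mor sf_qm (assoc X Y Z)
}.

Section Isos.
Variable C : category.

Definition iso_sym (X Y : C) (i : iso X Y) : iso Y X :=
  Iso (iso_invr i) (iso_invl i).

Definition iso_comp (X Y Z : C) (j : iso Y Z) (i : iso X Y) : iso X Z.
Proof.
refine (@Iso C X Z (j ∘ i) (iso_inv i ∘ iso_inv j) _ _).
- by rewrite comp_assoc -(comp_assoc _ (iso_inv j)) iso_invl comp_idr iso_invl.
- by rewrite comp_assoc -(comp_assoc _ i) iso_invr comp_idr iso_invr.
Defined.

Lemma iso_epi (X Y Z : C) (i : iso X Y) (f g : hom Y Z) :
  f ∘ i = g ∘ i -> f = g.
Proof.
move=> e; rewrite -(comp_idr f) -(comp_idr g) -(iso_invr i) !comp_assoc.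
by rewrite e.
Qed.

End Isos.

Definition iso_tens (G : magmoidal) (X X' Y Y' : G)
  (i : iso X X') (j : iso Y Y') : iso (X ⊗ Y) (X' ⊗ Y').
Proof.
refine (@Iso G _ _ (i ⊗₁ j) (iso_inv i ⊗₁ iso_inv j) _ _).
- by rewrite -tensm_comp !iso_invl tensm_id.
- by rewrite -tensm_comp !iso_invr tensm_id.
Defined.

Definition iso_id (C : category) (X : C) : iso X X :=
  Iso (comp_idl (idm X)) (comp_idl (idm X)).

Section LeftNucleus.
Variable G : magmoidal.

Record nuc_ob := NucOb {
  nuc_car : G;
  nuc_iso : forall X Y : G,
    iso (nuc_car ⊗ (X ⊗ Y)) ((nuc_car ⊗ X) ⊗ Y);
  nuc_nat : forall (X X' Y Y' : G) (g : hom X X') (h : hom Y Y'),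
    ((idm nuc_car ⊗₁ g) ⊗₁ h) ∘ nuc_iso X Y
    = nuc_iso X' Y' ∘ (idm nuc_car ⊗₁ (g ⊗₁ h))
}.

Record nuc_hom (A B : nuc_ob) := NucHom {
  nuc_mor :> hom (nuc_car A) (nuc_car B);
  nuc_comm : forall X Y : G,
    ((nuc_mor ⊗₁ idm X) ⊗₁ idm Y) ∘ nuc_iso A X Y
    = nuc_iso B X Y ∘ (nuc_mor ⊗₁ idm (X ⊗ Y))
}.

Lemma nuc_hom_eq (A B : nuc_ob) (f g : nuc_hom A B) :
  nuc_mor f = nuc_mor g -> f = g.
Proof.
case: f => f pf; case: g => g pg /= e; subst g.
by rewrite (proof_irrelevance _ pf pg).
Qed.

Definition nuc_idm (A : nuc_ob) : nuc_hom A A.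
Proof.
by refine (@NucHom A A (idm (nuc_car A)) _) => X Y;
  rewrite !tensm_id comp_idl comp_idr.
Defined.

Definition nuc_comp (A B C : nuc_ob) (g : nuc_hom B C) (f : nuc_hom A B) :
  nuc_hom A C.
Proof.
refine (@NucHom A C (nuc_mor g ∘ nuc_mor f) _) => X Y.
rewrite -(comp_idl (idm X)) -(comp_idl (idm Y)) !tensm_comp.
rewrite -comp_assoc nuc_comm comp_assoc nuc_comm.
by rewrite -comp_assoc -!tensm_comp !comp_idl.
Defined.

Definition nuc_cat : category.
Proof.
by refine (@Category nuc_ob nuc_hom nuc_idm nuc_comp _ _ _) => *;
  apply: nuc_hom_eq; rewrite /= ?comp_idl ?comp_idr ?comp_assoc.
Defined.

Lemma nuc_nat2 (A B : nuc_ob) (f : nuc_hom A B) (X X' Y Y' : G)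
    (g : hom X X') (h : hom Y Y') :
  ((f ⊗₁ g) ⊗₁ h) ∘ nuc_iso A X Y = nuc_iso B X' Y' ∘ (f ⊗₁ (g ⊗₁ h)).
Proof.
have -> : (nuc_mor f ⊗₁ g) ⊗₁ h
    = ((f ⊗₁ idm X') ⊗₁ idm Y') ∘ ((idm _ ⊗₁ g) ⊗₁ h).
  by rewrite -!tensm_comp !comp_idl comp_idr.
rewrite -comp_assoc nuc_nat comp_assoc nuc_comm -comp_assoc -tensm_comp.
by rewrite comp_idl comp_idr.
Qed.

(* [nuc_bar A B] is the family a|b, solved for from its defining equation
   [nuc_barE] by inverting the isomorphism a_{B,X⊗Y}. *)
Definition nuc_bar (A B : nuc_ob) (X Y : G) :
  iso ((nuc_car A ⊗ nuc_car B) ⊗ (X ⊗ Y))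
      (((nuc_car A ⊗ nuc_car B) ⊗ X) ⊗ Y) :=
  iso_comp (iso_tens (nuc_iso A (nuc_car B) X) (iso_id Y))
   (iso_comp (nuc_iso A (nuc_car B ⊗ X) Y)
     (iso_comp (iso_tens (iso_id (nuc_car A)) (nuc_iso B X Y))
       (iso_sym (nuc_iso A (nuc_car B) (X ⊗ Y))))).

Lemma nuc_barE (A B : nuc_ob) (X Y : G) :
  nuc_bar A B X Y ∘ nuc_iso A (nuc_car B) (X ⊗ Y)
  = (nuc_iso A (nuc_car B) X ⊗₁ idm Y) ∘ nuc_iso A (nuc_car B ⊗ X) Y
    ∘ (idm (nuc_car A) ⊗₁ nuc_iso B X Y).
Proof. by rewrite /= -!comp_assoc iso_invl comp_idr. Qed.

Lemma nuc_bar_nat (A A' B B' : nuc_ob) (f : nuc_hom A A') (g : nuc_hom B B')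
    (X X' Y Y' : G) (h : hom X X') (k : hom Y Y') :
  (((f ⊗₁ g) ⊗₁ h) ⊗₁ k) ∘ nuc_bar A B X Y
  = nuc_bar A' B' X' Y' ∘ ((f ⊗₁ g) ⊗₁ (h ⊗₁ k)).
Proof.
apply: (iso_epi (i := nuc_iso A (nuc_car B) (X ⊗ Y))).
rewrite -2!comp_assoc nuc_barE nuc_nat2 [RHS]comp_assoc nuc_barE !comp_assoc.
rewrite -[RHS]comp_assoc -[X in _ = _ ∘ X]tensm_comp -nuc_nat2.
rewrite comp_idl -[nuc_mor f in RHS]comp_idr tensm_comp !comp_assoc.
rewrite -(comp_assoc _ (iso_hom (nuc_iso A' _ _))) -nuc_nat2 !comp_assoc.
by rewrite -!tensm_comp nuc_nat2 comp_idl comp_idr.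
Qed.

Definition nuc_tens (A B : nuc_ob) : nuc_ob.
Proof.
refine (@NucOb (nuc_car A ⊗ nuc_car B) (nuc_bar A B) _) => X X' Y Y' g h.
rewrite -tensm_id; exact: (nuc_bar_nat (nuc_idm A) (nuc_idm B)).
Defined.

Definition nuc_tensm (A A' B B' : nuc_ob)
  (f : nuc_hom A A') (g : nuc_hom B B') :
  nuc_hom (nuc_tens A B) (nuc_tens A' B').
Proof.
refine (@NucHom (nuc_tens A B) (nuc_tens A' B') (f ⊗₁ g) _) => X Y.
rewrite -(tensm_id X Y); exact: nuc_bar_nat.
Defined.

Definition nuc_mag : magmoidal.
Proof.
refine (@Magmoidal nuc_cat nuc_tens nuc_tensm _ _).
- move=> X Y; apply: nuc_hom_eq; exact: tensm_id.
- move=> *; apply: nuc_hom_eq; exact: tensm_comp.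
Defined.

Lemma nuc_assoc_comm (A B C : nuc_ob) (X Y : G) :
  ((nuc_iso A (nuc_car B) (nuc_car C) ⊗₁ idm X) ⊗₁ idm Y)
    ∘ nuc_bar A (nuc_tens B C) X Y
  = nuc_bar (nuc_tens A B) C X Y
    ∘ (nuc_iso A (nuc_car B) (nuc_car C) ⊗₁ idm (X ⊗ Y)).
Proof.
set b := nuc_car B; set c := nuc_car C.
apply: (iso_epi (i := nuc_iso A (b ⊗ c) (X ⊗ Y))).
apply: (iso_epi (i := iso_tens (iso_id (nuc_car A)) (nuc_iso B c (X ⊗ Y)))).
rewrite [iso_hom (iso_tens _ _)]/=.
transitivity
  (((nuc_iso A b c ⊗₁ idm X) ∘ nuc_iso A (b ⊗ c) X
      ∘ (idm _ ⊗₁ nuc_iso B c X)) ⊗₁ idm Y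
    ∘ nuc_iso A (b ⊗ (c ⊗ X)) Y
    ∘ (idm _ ⊗₁ nuc_iso B (c ⊗ X) Y)
    ∘ (idm _ ⊗₁ (idm b ⊗₁ nuc_iso C X Y))).
- have e : (idm (nuc_car A) ⊗₁ nuc_iso (nuc_tens B C) X Y)
      ∘ (idm (nuc_car A) ⊗₁ nuc_iso B c (X ⊗ Y))
    = (idm (nuc_car A) ⊗₁ (nuc_iso B c X ⊗₁ idm Y))
      ∘ (idm (nuc_car A) ⊗₁ nuc_iso B (c ⊗ X) Y)
      ∘ (idm (nuc_car A) ⊗₁ (idm b ⊗₁ nuc_iso C X Y)).
    by rewrite -!tensm_comp !comp_idl -nuc_barE.
  rewrite -2![LHS]comp_assoc [X in _ ∘ X = _]comp_assoc.
  rewrite [X in _ ∘ (X ∘ _) = _](nuc_barE A (nuc_tens B C) X Y).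
  rewrite -[X in _ ∘ X = _]comp_assoc [X in _ ∘ (_ ∘ X) = _]e !comp_assoc.
  do 2 congr (_ ∘ _).
  rewrite -(comp_assoc _ (iso_hom (nuc_iso A _ Y))) -nuc_nat !comp_assoc.
  by rewrite -!tensm_comp !comp_idl.
- have e : nuc_bar (nuc_tens A B) C X Y ∘ nuc_bar A B c (X ⊗ Y)
    = (nuc_bar A B c X ⊗₁ idm Y) ∘ nuc_bar A B (c ⊗ X) Y
      ∘ (idm (nuc_car A ⊗ b) ⊗₁ nuc_iso C X Y).
    exact: (nuc_barE (nuc_tens A B) C X Y).
  rewrite -2![RHS]comp_assoc (comp_assoc (_ ⊗₁ idm (X ⊗ Y))).
  rewrite -(nuc_barE A B c (X ⊗ Y)) [RHS]comp_assoc e.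
  rewrite -[RHS]comp_assoc -tensm_id nuc_nat [RHS]comp_assoc.
  congr (_ ∘ _).
  rewrite -[RHS]comp_assoc nuc_barE !comp_assoc.
  by rewrite -tensm_comp nuc_barE comp_idl.
Qed.

Lemma nuc_assoc_inv_comm (A B C : nuc_ob) (X Y : G) :
  ((iso_inv (nuc_iso A (nuc_car B) (nuc_car C)) ⊗₁ idm X) ⊗₁ idm Y)
    ∘ nuc_bar (nuc_tens A B) C X Y
  = nuc_bar A (nuc_tens B C) X Y
    ∘ (iso_inv (nuc_iso A (nuc_car B) (nuc_car C)) ⊗₁ idm (X ⊗ Y)).
Proof.
set i := nuc_iso _ _ _.
apply: (iso_epi (i := iso_tens i (iso_id (X ⊗ Y)))).
rewrite [iso_hom (iso_tens _ _)]/=.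
transitivity (((iso_inv i ⊗₁ idm X) ⊗₁ idm Y)
  ∘ (((i ⊗₁ idm X) ⊗₁ idm Y) ∘ nuc_bar A (nuc_tens B C) X Y)).
- rewrite -[LHS]comp_assoc; congr (_ ∘ _).
  exact: (eq_sym (nuc_assoc_comm A B C X Y)).
- rewrite -[RHS]comp_assoc -tensm_comp iso_invl comp_idl tensm_id comp_idr.
  by rewrite comp_assoc -!tensm_comp iso_invl !comp_idl !tensm_id comp_idl.
Qed.

Definition nuc_assoc (A B C : nuc_mag) : iso (A ⊗ (B ⊗ C)) ((A ⊗ B) ⊗ C).
Proof.
refine (@Iso nuc_mag (A ⊗ (B ⊗ C)) ((A ⊗ B) ⊗ C)
  (@NucHom (nuc_tens A (nuc_tens B C)) (nuc_tens (nuc_tens A B) C)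
     (nuc_iso A (nuc_car B) (nuc_car C)) (@nuc_assoc_comm A B C))
  (@NucHom (nuc_tens (nuc_tens A B) C) (nuc_tens A (nuc_tens B C))
     (iso_inv (nuc_iso A (nuc_car B) (nuc_car C)))
     (@nuc_assoc_inv_comm A B C)) _ _);
  apply: nuc_hom_eq; [exact: iso_invl | exact: iso_invr].
Defined.

Definition left_nucleus : semigroupal.
Proof.
refine (@Semigroupal nuc_mag nuc_assoc _ _).
- move=> *; apply: nuc_hom_eq; exact: nuc_nat2.
- move=> A B C D; apply: nuc_hom_eq; exact: nuc_barE.
Defined.

End LeftNucleus.

Definition tensor_closed (C : magmoidal) (P : C -> Prop) : Prop :=
  forall A B : C, P A -> P B -> P (A ⊗ B).

Section FullSub.
Variables (C : semigroupal) (P : C -> Prop) (cl : tensor_closed P).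

Definition full_cat : category :=
  @Category {A : C | P A} (fun A B => hom (proj1_sig A) (proj1_sig B))
    (fun A => idm (proj1_sig A)) (fun _ _ _ g f => g ∘ f)
    (fun _ _ f => comp_idl f) (fun _ _ f => comp_idr f)
    (fun _ _ _ _ h g f => comp_assoc h g f).

Definition full_mag : magmoidal :=
  @Magmoidal full_cat
    (fun A B => exist P (proj1_sig A ⊗ proj1_sig B)
                  (cl (proj2_sig A) (proj2_sig B)))
    (fun _ _ _ _ f g => tensm (m := C) f g)
    (fun A B => tensm_id (proj1_sig A) (proj1_sig B))
    (fun _ _ _ _ _ _ f' f g' g => tensm_comp (m := C) f' f g' g).

Definition full_iso (A B : full_cat) (i : iso (proj1_sig A) (proj1_sig B)) :
  iso A B := @Iso full_cat A B i (iso_inv i) (iso_invl i) (iso_invr i).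

Definition full_semigroupal : semigroupal :=
  @Semigroupal full_mag
    (fun A B D => @full_iso (A ⊗ (B ⊗ D)) ((A ⊗ B) ⊗ D)
       (assoc (proj1_sig A) (proj1_sig B) (proj1_sig D)))
    (fun _ _ _ _ _ _ f g h => assoc_nat (s := C) f g h)
    (fun A B D E => pentagon (proj1_sig A) (proj1_sig B)
                      (proj1_sig D) (proj1_sig E)).

End FullSub.

Definition in_nucleus_of (G : magmoidal) (H : semigroupal)
    (F : quasi_monoidal_functor G H) (A : left_nucleus G) : Prop :=
  forall X Y : G,
    assoc (F (nuc_car A)) (F X) (F Y)
      ∘ (idm (F (nuc_car A)) ⊗₁ qm_str F X Y) ∘ qm_str F (nuc_car A) (X ⊗ Y)
    = (qm_str F (nuc_car A) X ⊗₁ idm (F Y))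
      ∘ qm_str F (nuc_car A ⊗ X) Y ∘ qm_mor F (nuc_iso A X Y).

(* Main.v *)
(* After precomposing with F(a_{B,X⊗Y}) and postcomposing with
   (F_{A,B} ⊗ F(X)) ⊗ F(Y), the defining equation of N_l(F) for (A⊗B, a|b)
   follows from those of (A,a) and (B,b), naturality, and the pentagon in H.
   The coherence of the lifted functor is the defining equation of N_l(F). *)
From Stdlib Require Import ssreflect.
Require Import Defs.
Open Scope cat_scope.

(** Lets a commuting square be rewritten at two adjacent factors inside a left-associated
    composite. *)
Lemma comp_square {C : category} {V W X X' Y : C} {g : hom X Y} {f : hom W X}
    {g' : hom X' Y} {f' : hom W X'} (e : g ∘ f = g' ∘ f') (h : hom Y V) :
  h ∘ g ∘ f = h ∘ g' ∘ f'.
Proof. by rewrite -!comp_assoc e. Qed.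

Lemma iso_mono {C : category} {X Y Z : C} (i : iso Y Z) (f g : hom X Y) :
  i ∘ f = i ∘ g -> f = g.
Proof.
move=> e; rewrite -(comp_idl f) -(comp_idl g) -(iso_invl i) -!comp_assoc.
by rewrite e.
Qed.

Lemma tensm_compl {G : magmoidal} (W : G) {X Y Z : G}
    (g : hom Y Z) (f : hom X Y) :
  idm W ⊗₁ (g ∘ f) = (idm W ⊗₁ g) ∘ (idm W ⊗₁ f).
Proof. by rewrite -tensm_comp comp_idl. Qed.

Lemma tensm_compr {G : magmoidal} (W : G) {X Y Z : G}
    (g : hom Y Z) (f : hom X Y) :
  (g ∘ f) ⊗₁ idm W = (g ⊗₁ idm W) ∘ (f ⊗₁ idm W).
Proof. by rewrite -tensm_comp comp_idl. Qed.

Lemma tensm_interchange {G : magmoidal} {X X' Y Y' : G}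
    (f : hom X X') (g : hom Y Y') :
  (f ⊗₁ idm Y') ∘ (idm X ⊗₁ g) = (idm X' ⊗₁ g) ∘ (f ⊗₁ idm Y).
Proof. by rewrite -!tensm_comp !comp_idl !comp_idr. Qed.

Section Closure.
Variables (G : magmoidal) (H : semigroupal) (F : quasi_monoidal_functor G H).

Lemma qm_natl (W : G) {X Y : G} (f : hom X Y) :
  qm_str F W Y ∘ qm_mor F (idm W ⊗₁ f)
  = (idm (F W) ⊗₁ qm_mor F f) ∘ qm_str F W X.
Proof. by rewrite -qm_nat qm_id. Qed.

Lemma qm_natr (W : G) {X Y : G} (f : hom X Y) :
  qm_str F Y W ∘ qm_mor F (f ⊗₁ idm W)
  = (qm_mor F f ⊗₁ idm (F W)) ∘ qm_str F X W.
Proof. by rewrite -qm_nat qm_id. Qed.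

Definition qm_mor_iso {X Y : G} (i : iso X Y) : iso (F X) (F Y).
Proof.
refine (@Iso H _ _ (qm_mor F i) (qm_mor F (iso_inv i)) _ _).
- by rewrite -qm_comp iso_invl qm_id.
- by rewrite -qm_comp iso_invr qm_id.
Defined.

Lemma in_nucleus_of_tens :
  tensor_closed (C := left_nucleus G) (@in_nucleus_of G H F).
Proof.
move=> A B hA hB X Y; change (nuc_ob G) in A, B.
change (nuc_iso (nuc_tens A B)) with (nuc_bar A B).
change (nuc_car (nuc_tens A B)) with (nuc_car A ⊗ nuc_car B).
set a := nuc_car A; set b := nuc_car B.
(* The family a|b is characterised by [nuc_barE] only after precomposition with [nuc_iso A], hence
   this cancellation. *)
apply: (iso_epi (i := qm_mor_iso (nuc_iso A b (X ⊗ Y)))).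
apply: (iso_mono
  (iso_tens (iso_tens (qm_str F a b) (iso_id (F X))) (iso_id (F Y)))).
rewrite [iso_hom (iso_tens _ _)]/= [iso_hom (qm_mor_iso _)]/=.
rewrite -/a -/b.
(* The defining equation of (A,a) at (Z,T), postcomposed with [k] and left-associated for
   rewriting. *)
have whisk V Z T (k : hom _ V) :
    k ∘ assoc (F a) (F Z) (F T) ∘ (idm (F a) ⊗₁ qm_str F Z T)
      ∘ qm_str F a (Z ⊗ T)
    = k ∘ (qm_str F a Z ⊗₁ idm (F T)) ∘ qm_str F (a ⊗ Z) T
      ∘ qm_mor F (nuc_iso A Z T).
  by rewrite -2!comp_assoc (comp_assoc (assoc _ _ _)) hA !comp_assoc.
(* The common value first splits F(A⊗(B⊗(X⊗Y))) completely, then reassociates along the three-edge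
   side of the pentagon in H. *)
transitivity
  ((assoc (F a) (F b) (F X) ⊗₁ idm (F Y)) ∘ assoc (F a) (F b ⊗ F X) (F Y)
   ∘ (idm (F a) ⊗₁ assoc (F b) (F X) (F Y))
   ∘ (idm (F a) ⊗₁ (idm (F b) ⊗₁ qm_str F X Y))
   ∘ (idm (F a) ⊗₁ qm_str F b (X ⊗ Y)) ∘ qm_str F a (b ⊗ (X ⊗ Y))).
(* Uses the two-edge side of the pentagon; [whisk] is applied at (B, X⊗Y). *)
- rewrite -pentagon !comp_assoc assoc_nat tensm_id.
  rewrite (comp_square (tensm_interchange _ _)).
  rewrite -whisk.
  by rewrite -(tensm_id (F a)) (comp_square (assoc_nat _ _ _)).
(* Each factor of [nuc_barE] yields one edge of the three-edge side: [hA] at (B,X) tensored with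
   F(Y), [whisk] at (B⊗X, Y), and [hB] at (X,Y) tensored with F(A). *)
- rewrite -(comp_assoc _ (qm_mor F _) (qm_mor F _)) -qm_comp nuc_barE -/a -/b.
  rewrite !qm_comp !comp_assoc.
  rewrite (comp_square (qm_natr _ _)) -!tensm_compr -hA.
  rewrite !tensm_compr -whisk.
  rewrite (comp_square (qm_natl _ _)) (comp_square (assoc_nat _ _ _)).
  have := f_equal (tensm (idm (F a))) (hB X Y); rewrite !tensm_compl => e.
  congr (_ ∘ _).
  have := comp_square e ((assoc (F a) (F b) (F X) ⊗₁ idm (F Y))
    ∘ assoc (F a) (F b ⊗ F X) (F Y)).
  by rewrite !comp_assoc.
Qed.

End Closure.

Theorem proposition2p4p1 (G : magmoidal) (H : semigroupal)
    (F : quasi_monoidal_functor G H) :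
  exists cl : tensor_closed (C := left_nucleus G) (@in_nucleus_of G H F),
  exists Fbar : semigroupal_functor (full_semigroupal cl) H,
    qm_dat Fbar =
    QmData (C := full_semigroupal cl) (D := H)
      (qm_ob := fun A => F (nuc_car (proj1_sig A)))
      (fun A B f => qm_mor F (nuc_mor f))
      (fun A B => qm_str F (nuc_car (proj1_sig A)) (nuc_car (proj1_sig B))).
Proof.
pose cl := @in_nucleus_of_tens G H F; exists cl.
(* A transparent [let] keeps the data of [Q] visible, so the final equality holds by [eq_refl]. *)
unshelve refine (let Q : quasi_monoidal_functor (full_semigroupal cl) H :=
  @QuasiMonoidalFunctor (full_semigroupal cl) H
    (QmData (C := full_semigroupal cl) (D := H)
      (qm_ob := fun A => F (nuc_car (proj1_sig A)))
      (fun A B f => qm_mor F (nuc_mor f))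
      (fun A B => qm_str F (nuc_car (proj1_sig A)) (nuc_car (proj1_sig B))))
    _ _ _ in _).
- move=> A; exact: qm_id.
- move=> A B C g f; exact: qm_comp.
- move=> A A' B B' f g; exact: qm_nat.
- refine (ex_intro _ (@SemigroupalFunctor (full_semigroupal cl) H Q _) eq_refl).
  (* The constraint of the nucleus is a_{B,C}, so coherence is [hA] at the carriers of [B] and
     [C]. *)
  by case=> A hA [B hB] [C hC]; exact: hA.
Qed.
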